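(* Let $-1<p\leq -1/2$ and let $j_{p,1}$ be the first positive zero of the Bessel function $J_p$. Then, with $$\alpha=\frac{1}{8(p+1)(p+3)}\qquad\text{and}\qquad \beta=\frac{\frac{1}{p+1}-\frac{p+2}{p+1}\mathcal{J}_{p+1}(j_{p,1})}{j_{p,1}^2\left(1-\mathcal{J}_{p+1}(j_{p,1})\right)},$$ the inequalities $$\frac{\left(\frac{p+2}{p+1}-\alpha x^2\right)\mathcal{J}_{p+1}(x)}{\frac{1}{p+1}+\mathcal{J}_p(x)-\alpha x^2}<1<\frac{\left(\frac{p+2}{p+1}-\beta x^2\right)\mathcal{J}_{p+1}(x)}{\frac{1}{p+1}+\mathcal{J}_p(x)-\beta x^2}$$ hold for all $x\in(0,j_{p,1})$. Moreover these constants $\alpha$ and $\beta$ are best possible: the left-hand inequality fails for some $x\in(0,j_{p,1})$ if $\alpha$ is replaced by any larger constant, and the right-hand inequality fails for some $x\in(0,j_{p,1})$ if $\beta$ is replaced by any smaller constant.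
   Context: For $q>-1$, $J_q(x)=\sum_{n\geq 0}\frac{(-1)^n (x/2)^{q+2n}}{n!\,\Gamma(q+n+1)}$ (for $x>0$) is the Bessel function of the first kind of order $q$. The normalized function $\mathcal{J}_q:\mathbb{R}\to\mathbb{R}$ is defined by $$\mathcal{J}_q(x)=2^q\Gamma(q+1)x^{-q}J_q(x)=\sum_{n\geq 0}\frac{(-1/4)^n}{(q+1)_n\, n!}x^{2n},$$ where $(q+1)_n=\Gamma(q+n+1)/\Gamma(q+1)$ is the Pochhammer symbol (the power series defines $\mathcal{J}_q$ for all real $x$, including $x=0$). *)

(* Defs.v *)
From Stdlib Require Import Reals Factorial.
From Coquelicot Require Import Coquelicot.
Open Scope R_scope.

(** Euler's integral; it converges, and so is meaningful, only for [0 < s]. *)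
Definition Gamma (s : R) : R :=
  RInt_gen (fun t : R => Rpower t (s - 1) * exp (- t))
           (at_right 0) (Rbar_locally p_infty).

Definition Pochhammer (a : R) (n : nat) : R := Gamma (a + INR n) / Gamma a.

(** Meaningful for [-1 < q] and [0 < x] only ([Rpower] needs a positive base). *)
Definition BesselJ (q x : R) : R :=
  Series (fun n : nat =>
    (-1) ^ n * Rpower (x / 2) (q + 2 * INR n)
    / (INR (fact n) * Gamma (q + INR n + 1))).

(** The power series of [2^q Gamma(q+1) x^(-q) J_q(x)], which makes sense at
    every real [x], including [x <= 0]. *)
Definition normBesselJ (q x : R) : R :=
  Series (fun n : nat =>
    (-1 / 4) ^ n / (Pochhammer (q + 1) n * INR (fact n)) * x ^ (2 * n)).

Definition first_positive_zero (f : R -> R) (j : R) : Prop :=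
  0 < j /\ f j = 0 /\ forall x : R, 0 < x < j -> f x <> 0.

Definition cusa_num (p c x : R) : R :=
  ((p + 2) / (p + 1) - c * x ^ 2) * normBesselJ (p + 1) x.

Definition cusa_den (p c x : R) : R :=
  1 / (p + 1) + normBesselJ p x - c * x ^ 2.

Definition alpha (p : R) : R := 1 / (8 * (p + 1) * (p + 3)).

Definition beta (p j : R) : R :=
  (1 / (p + 1) - (p + 2) / (p + 1) * normBesselJ (p + 1) j)
  / (j ^ 2 * (1 - normBesselJ (p + 1) j)).

(* Main.v *)
(** Put [y = x ^ 2 / 4], [u = J_p(x)], [v = J_(p+1)(x)] (normalized) and
    [F = (1/(p+1) + u - (p+2)/(p+1) v) / (x ^ 2 (1 - v))].  As [v < 1], the two
    inequalities say [alpha < F(x) < beta], where [alpha = F(0+)] and, since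
    [J_p(j) = 0], [beta = F(j)].  Expanding in powers of [y] gives
    [F - alpha = h / (4 b)], where [b = (1 - v) / y] and [h] have alternating power
    series whose coefficients shrink so fast that on [0 < y <= 1] [b] is positive and
    decreasing and [h] is increasing from [0].  The point [j] is in this range because
    the series of [u] is negative at [y = 2 (p + 1) <= 1]. *)

Require Import Defs.
From Stdlib Require Import Reals Lra Lia Psatz Factorial Classical_Prop.
From Coquelicot Require Import Coquelicot.
Open Scope R_scope.

(** * Improper integrals over the positive half-line *)

Lemma exp_le x y : x <= y -> exp x <= exp y.
Proof. intros [H| ->]; [left; now apply exp_increasing|right; reflexivity]. Qed.

Lemma at_right_0_pos : at_right 0 (fun t => 0 < t).
Proof. exists (mkposreal 1 Rlt_0_1); intros t _ Ht; exact Ht. Qed.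

Lemma p_infty_pos : Rbar_locally p_infty (fun t => 0 < t).
Proof. exists 0; intros t Ht; exact Ht. Qed.

(** Fundamental theorem of calculus on the open half-line: both end points of the integration
    interval are eventually positive along the two filters, so facts on [0 < x] suffice. *)
Lemma is_RInt_gen_primitive (F f : R -> R) (la lb : R) :
  (forall x, 0 < x -> is_derive F x (f x)) ->
  (forall x, 0 < x -> continuous f x) ->
  filterlim F (at_right 0) (locally la) ->
  filterlim F (Rbar_locally p_infty) (locally lb) ->
  is_RInt_gen f (at_right 0) (Rbar_locally p_infty) (lb - la).
Proof.
  intros HF Hf Ha Hb.
  assert (Hpos : forall P : R -> Prop, (forall x, 0 < x -> P x) ->
    filter_prod (at_right 0) (Rbar_locally p_infty)
      (fun ab => forall x, Rmin (fst ab) (snd ab) <= x <= Rmax (fst ab) (snd ab) -> P x)).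
  { intros P HP.
    apply (Filter_prod _ _ _ _ _ at_right_0_pos p_infty_pos).
    intros a b Hpa Hpb x [Hx _]; apply HP; simpl in Hx.
    apply Rlt_le_trans with (2 := Hx); now apply Rmin_glb_lt. }
  apply (is_RInt_gen_ext (Derive F)).
  - generalize (Hpos (fun x => Derive F x = f x)).
    intros H; eapply filter_imp; [|apply H; intros x Hx; now apply is_derive_unique, HF].
    intros [a b] Hab x Hx; apply Hab; lra.
  - apply is_RInt_gen_Derive; try assumption.
    + apply (Hpos (fun x => ex_derive F x)); intros x Hx; exists (f x); now apply HF.
    + apply (Hpos (fun x => continuous (Derive F) x)); intros x Hx.
      apply (continuous_ext_loc _ f); [|now apply Hf].
      assert (Hx' : locally x (fun t => 0 < t)) by now apply open_gt.
      revert Hx'; apply filter_imp; intros t Ht; symmetry.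
      now apply is_derive_unique, HF.
Qed.

(** The limit is the supremum of the values on the half-line. The bound by [l] is kept because the
    strict positivity of Gamma is read off from it. *)
Lemma incr_bounded_lim_p_infty (F : R -> R) (M : R) :
  (forall x y, 0 < x -> x <= y -> F x <= F y) ->
  (forall x, 0 < x -> F x <= M) ->
  exists l, filterlim F (Rbar_locally p_infty) (locally l) /\
    forall x, 0 < x -> F x <= l.
Proof.
  intros Hincr Hbnd.
  destruct (completeness (fun v => exists x, 0 < x /\ v = F x)) as [l [Hub Hlub]].
  - exists M; intros v [x [Hx ->]]; now apply Hbnd.
  - exists (F 1), 1; split; [lra|reflexivity].
  - assert (Hle : forall x, 0 < x -> F x <= l) by (intros x Hx; apply Hub; now exists x).
    exists l; split; [|exact Hle].
    apply filterlim_locally; intros eps.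
    destruct (classic (exists x, 0 < x /\ l - eps < F x)) as [[x [Hx Hxl]]|Hno].
    + exists x; intros t Ht.
      assert (F x <= F t) by (apply Hincr; lra).
      assert (F t <= l) by (apply Hle; lra).
      change (Rabs (F t - l) < eps); apply Rabs_def1; destruct eps; simpl in *; lra.
    + exfalso; assert (l <= l - eps); [|destruct eps; simpl in *; lra].
      apply Hlub; intros v [x [Hx ->]]; apply Rnot_lt_le; intros H; apply Hno; now exists x.
Qed.

(** Reduced to the limit at infinity through the increasing function [- F (/ x)]. *)
Lemma incr_bounded_lim_at_right_0 (F : R -> R) (m : R) :
  (forall x y, 0 < x -> x <= y -> F x <= F y) ->
  (forall x, 0 < x -> m <= F x) ->
  exists l, filterlim F (at_right 0) (locally l) /\
    forall x, 0 < x -> l <= F x.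
Proof.
  intros Hincr Hbnd.
  destruct (incr_bounded_lim_p_infty (fun x => - F (/ x)) (- m)) as [l [Hl Hle]].
  - intros x y Hx Hxy; apply Ropp_le_contravar, Hincr;
      [apply Rinv_0_lt_compat|apply Rinv_le_contravar]; lra.
  - intros x Hx; apply Ropp_le_contravar, Hbnd, Rinv_0_lt_compat, Hx.
  - exists (- l); split.
    + apply (filterlim_ext_loc (fun x => - (- F (/ / x)))).
      { generalize at_right_0_pos; apply filter_imp; intros x Hx.
        rewrite Rinv_inv; ring. }
      eapply filterlim_comp; [|apply (filterlim_opp l)].
      apply (filterlim_comp _ _ _ Rinv (fun x => - F (/ x)) _ _ _ filterlim_Rinv_0_right Hl).
    + intros x Hx; generalize (Hle (/ x) (Rinv_0_lt_compat _ Hx)); rewrite Rinv_inv; lra.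
Qed.

(** * Convergence, positivity and functional equation of Euler's integral *)

Definition gamma_integrand (s t : R) : R := Rpower t (s - 1) * exp (- t).

(** Convergence and value in one relation; nothing can be deduced about [Gamma s] itself before some
    [l] is known to satisfy it. *)
Definition is_Gamma (s l : R) : Prop :=
  is_RInt_gen (gamma_integrand s) (at_right 0) (Rbar_locally p_infty) l.

Lemma is_Gamma_unique s l : is_Gamma s l -> Gamma s = l.
Proof. exact (is_RInt_gen_unique (V := R_CompleteNormedModule) _ l). Qed.

(** Integration by parts in differential form: integrating this derivative over the half-line yields
    the functional equation. *)
Lemma is_derive_gamma_integrand s t : 0 < t ->
  is_derive (gamma_integrand (s + 1)) t (s * gamma_integrand s t - gamma_integrand (s + 1) t).
Proof.
  intros Ht; unfold gamma_integrand, Rpower.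
  replace (s + 1 - 1) with s by ring.
  auto_derive; [exact Ht|].
  replace (exp (s * ln t)) with (exp ((s - 1) * ln t) * t).
  - field; lra.
  - rewrite <- (exp_ln t Ht) at 2; rewrite <- exp_plus; f_equal; ring.
Qed.

Lemma continuous_gamma_integrand s t : 0 < t -> continuous (gamma_integrand s) t.
Proof.
  intros Ht; apply (ex_derive_continuous (gamma_integrand s)).
  replace s with ((s - 1) + 1) by ring.
  eexists; now apply is_derive_gamma_integrand.
Qed.

Lemma gamma_integrand_pos s t : 0 < gamma_integrand s t.
Proof. unfold gamma_integrand, Rpower; apply Rmult_lt_0_compat; apply exp_pos. Qed.

Lemma gamma_integrand_lim_0 s : 0 < s ->
  filterlim (gamma_integrand (s + 1)) (at_right 0) (locally 0).
Proof.
  intros Hs.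
  assert (H1 : filterlim (fun t => exp (s * ln t)) (at_right 0) (locally 0)).
  { apply (filterlim_comp _ _ _ (fun t => s * ln t) exp _ (Rbar_locally m_infty)).
    - intros P [M HM].
      generalize (is_lim_ln_0 (fun y => y < M / s) (ex_intro _ (M / s) (fun y Hy => Hy))).
      unfold filtermap; apply filter_imp; intros t Ht; apply HM.
      apply (Rmult_lt_compat_l s) in Ht; [|exact Hs].
      replace (s * (M / s)) with M in Ht by (field; lra); exact Ht.
    - apply is_lim_exp_m. }
  apply (filterlim_le_le (fun _ => 0) _ (fun t => exp (s * ln t)) (Finite 0));
    [|apply filterlim_const|exact H1].
  generalize at_right_0_pos; apply filter_imp; intros t Ht; split.
  - left; apply gamma_integrand_pos.
  - unfold gamma_integrand, Rpower; rewrite <- exp_plus; apply exp_le.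
    replace (s + 1 - 1) with s by ring; lra.
Qed.

Lemma gamma_integrand_lim_p_infty s : 0 < s ->
  filterlim (gamma_integrand (s + 1)) (Rbar_locally p_infty) (locally 0).
Proof.
  intros Hs.
  (* Chosen so that [s * ln t - t <= C - t / 2], which leaves an exponentially decaying majorant. *)
  set (C := s * ln (2 * s) - s).
  apply (filterlim_le_le (fun _ => 0) _ (fun t => exp (C - t / 2)) (Finite 0));
    [|apply filterlim_const|].
  - generalize p_infty_pos; apply filter_imp; intros t Ht; split.
    + left; apply gamma_integrand_pos.
    + unfold gamma_integrand, Rpower; rewrite <- exp_plus; apply exp_le.
      replace (s + 1 - 1) with s by ring.
      (* [ln u <= u - 1] at [u = t / (2 s)] *)
      assert (Hu : 0 < t / (2 * s)) by (apply Rdiv_lt_0_compat; lra).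
      assert (Hln : ln (t / (2 * s)) <= t / (2 * s) - 1).
      { generalize (exp_ineq1_le (ln (t / (2 * s)))); rewrite exp_ln by exact Hu; lra. }
      unfold Rdiv in Hln at 1; rewrite ln_mult, ln_Rinv in Hln;
        try lra; try (apply Rinv_0_lt_compat; lra).
      apply (Rmult_le_compat_l s) in Hln; [|lra].
      replace (s * (t / (2 * s) - 1)) with (t / 2 - s) in Hln by (field; lra).
      unfold C; lra.
  - apply (filterlim_comp _ _ _ (fun t => C - t / 2) exp _ (Rbar_locally m_infty));
      [|apply is_lim_exp_m].
    intros P [M HM]; exists (2 * (C - M)); intros t Ht; apply HM; lra.
Qed.

Lemma is_RInt_gen_derive_gamma s : 0 < s ->
  is_RInt_gen (fun t => s * gamma_integrand s t - gamma_integrand (s + 1) t)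
    (at_right 0) (Rbar_locally p_infty) 0.
Proof.
  intros Hs; replace 0 with (0 - 0) at 2 by ring.
  apply (is_RInt_gen_primitive (gamma_integrand (s + 1))).
  - intros x Hx; now apply is_derive_gamma_integrand.
  - intros x Hx; apply (continuous_minus (fun t => s * gamma_integrand s t)).
    + apply (continuous_scal_r s (gamma_integrand s)); now apply continuous_gamma_integrand.
    + now apply continuous_gamma_integrand.
  - now apply gamma_integrand_lim_0.
  - now apply gamma_integrand_lim_p_infty.
Qed.

(** Subtracting the exact derivative, whose integral is 0, from [s] times the integrand at [s]
    leaves the integrand at [s + 1]. *)
Lemma is_Gamma_succ s l : 0 < s -> is_Gamma s l -> is_Gamma (s + 1) (s * l).
Proof.
  intros Hs Hl.
  generalize (is_RInt_gen_minus _ _ _ _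
    (is_RInt_gen_scal _ s _ Hl) (is_RInt_gen_derive_gamma s Hs)).
  unfold minus, plus, opp, scal; simpl; unfold mult; simpl.
  replace (s * l + - 0) with (s * l) by ring.
  apply is_RInt_gen_ext; apply filter_forall; intros ab x _.
  match goal with |- ?a = ?b => change (@eq R a b) end; ring.
Qed.

(** The same identity read backwards. It gives convergence for [s < 1], where the integrand is
    unbounded near 0. *)
Lemma is_Gamma_pred s l : 0 < s -> is_Gamma (s + 1) l -> is_Gamma s (l / s).
Proof.
  intros Hs Hl.
  generalize (is_RInt_gen_scal _ (/ s) _
    (is_RInt_gen_plus _ _ _ _ Hl (is_RInt_gen_derive_gamma s Hs))).
  unfold plus, scal; simpl; unfold mult; simpl.
  replace (/ s * (l + 0)) with (l / s) by (field; lra).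
  apply is_RInt_gen_ext; apply filter_forall; intros ab x _.
  match goal with |- ?a = ?b => change (@eq R a b) end; field; lra.
Qed.

Lemma Rpower_le_1_plus t r : 0 < t -> 0 <= r <= 1 -> Rpower t r <= 1 + t.
Proof.
  intros Ht Hr; destruct (Rle_lt_dec t 1) as [H|H].
  - assert (ln t <= 0) by (rewrite <- ln_1; now apply ln_le).
    assert (Rpower t r <= exp 0) by (apply exp_le; nra).
    rewrite exp_0 in *; lra.
  - assert (0 <= ln t) by (rewrite <- ln_1; apply ln_le; lra).
    assert (Rpower t r <= exp (ln t)) by (apply exp_le; nra).
    rewrite exp_ln in *; lra.
Qed.

(** For these [s] the integrand is at most [(1 + t) * exp (- t)], which has the bounded primitive
    [B]. The primitive [F] is increasing and grows no faster than [B], so it has finite limits at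
    both ends. *)
Lemma is_Gamma_base s : 1 <= s <= 2 -> exists l, 0 < l /\ is_Gamma s l.
Proof.
  intros Hs.
  set (f := gamma_integrand s); set (F := (RInt f 1) : R -> R).
  set (B := fun t => - (2 + t) * exp (- t)).
  assert (HF : forall x, 0 < x -> is_derive F x (f x)).
  { intros x Hx; apply (is_derive_RInt f F 1); [|now apply continuous_gamma_integrand].
    assert (Hx' : locally x (fun t => 0 < t)) by now apply open_gt.
    revert Hx'; apply filter_imp; intros t Ht; apply (RInt_correct f 1 t), (ex_RInt_continuous f).
    intros z [Hz _]; apply continuous_gamma_integrand.
    apply Rlt_le_trans with (2 := Hz); apply Rmin_glb_lt; lra. }
  assert (HB : forall x, is_derive B x ((1 + x) * exp (- x))).
  { intros x; unfold B; auto_derive; [exact I|ring]. }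
  (* The mean value theorem is applied to [F], whose derivative is positive, and to [B - F], whose
     derivative is nonnegative. *)
  assert (HFB : forall x y, 0 < x -> x < y -> F x < F y /\ F y - F x <= B y - B x).
  { intros x y Hx Hxy.
    destruct (MVT_gen (fun t => F t) x y f) as [c [Hc Heq]].
    - intros z Hz; apply HF; rewrite Rmin_left in Hz; lra.
    - intros z Hz; apply continuity_pt_filterlim, (ex_derive_continuous F).
      exists (f z); apply HF; rewrite Rmin_left in Hz; lra.
    - destruct (MVT_gen (fun t => B t - F t) x y (fun t => (1 + t) * exp (- t) - f t))
        as [d [Hd Heq']].
      + intros z Hz; apply (is_derive_minus B F); [apply HB|].
        apply HF; rewrite Rmin_left in Hz; lra.
      + intros z Hz; apply continuity_pt_filterlim, (ex_derive_continuous (fun t => B t - F t)).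
        eexists; apply (is_derive_minus B F); [apply HB|].
        apply HF; rewrite Rmin_left in Hz; lra.
      + rewrite Rmin_left, Rmax_right in Hc, Hd by lra.
        generalize (gamma_integrand_pos s c); fold f; intros Hfc.
        assert (Hfd : f d <= (1 + d) * exp (- d)).
        { apply Rmult_le_compat_r; [left; apply exp_pos|apply Rpower_le_1_plus; lra]. }
        split; nra. }
  assert (HB0 : forall x, 0 < x -> -3 <= B x <= 0).
  { intros x Hx; unfold B.
    generalize (exp_pos (- x)) (exp_ineq1_le x); intros H1 H2.
    assert (H3 : exp x * exp (- x) = 1) by (rewrite <- exp_plus, Rplus_opp_r; apply exp_0).
    split; nra. }
  assert (HF1 : F 1 = 0) by apply (RInt_point (V := R_CompleteNormedModule)).
  assert (Hincr : forall x y, 0 < x -> x <= y -> F x <= F y).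
  { intros x y Hx [Hxy|<-]; [left; now apply HFB|right; reflexivity]. }
  generalize (HB0 1 Rlt_0_1); intros HB1.
  destruct (incr_bounded_lim_p_infty F 3) as [lb [Hlb Hb]]; [exact Hincr| |].
  { intros x Hx; specialize (HB0 x Hx).
    destruct (Rle_lt_dec x 1) as [H|H].
    - specialize (Hincr x 1 Hx H); lra.
    - destruct (HFB 1 x Rlt_0_1 H); lra. }
  destruct (incr_bounded_lim_at_right_0 F (-3)) as [la [Hla Ha]]; [exact Hincr| |].
  { intros x Hx; specialize (HB0 x Hx).
    destruct (Rle_lt_dec 1 x) as [H|H].
    - specialize (Hincr 1 x Rlt_0_1 H); lra.
    - destruct (HFB x 1 Hx H); lra. }
  exists (lb - la); split.
  - generalize (Ha 1 Rlt_0_1) (Hb 2 Rlt_0_2).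
    destruct (HFB 1 2); lra.
  - apply (is_RInt_gen_primitive F); try assumption.
    intros x Hx; now apply continuous_gamma_integrand.
Qed.

Lemma is_Gamma_Gamma s : 0 < s -> 0 < Gamma s /\ is_Gamma s (Gamma s).
Proof.
  intros Hs.
  assert (H : exists l, 0 < l /\ is_Gamma s l).
  (* Induction on the unit interval containing [s]: the lowest one is reached from [1 <= s + 1 <= 2]
     by stepping down, the others by stepping up. *)
  { assert (Hn : forall n s, 0 < s <= INR n + 1 -> exists l, 0 < l /\ is_Gamma s l).
    { induction n as [|n IH]; intros r Hr.
      - simpl in Hr; destruct (is_Gamma_base (r + 1)) as [l [Hl Hl']]; [lra|].
        exists (l / r); split; [apply Rdiv_lt_0_compat; lra|now apply is_Gamma_pred].
      - rewrite S_INR in Hr; destruct (Rle_lt_dec r 1) as [H|H].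
        + apply IH; generalize (pos_INR n); lra.
        + destruct (IH (r - 1)) as [l [Hl Hl']]; [lra|].
          exists ((r - 1) * l); split; [nra|].
          replace r with (r - 1 + 1) at 1 by ring; apply is_Gamma_succ; [lra|exact Hl']. }
    destruct (INR_unbounded s) as [n Hn']; apply (Hn n); lra. }
  destruct H as [l [Hl Hl']]; now rewrite (is_Gamma_unique _ _ Hl').
Qed.

Lemma Gamma_pos s : 0 < s -> 0 < Gamma s.
Proof. apply is_Gamma_Gamma. Qed.

Lemma Gamma_succ s : 0 < s -> Gamma (s + 1) = s * Gamma s.
Proof.
  intros Hs; apply is_Gamma_unique, is_Gamma_succ; [exact Hs|now apply is_Gamma_Gamma].
Qed.

(** * Power series of the normalized Bessel function in [y = x ^ 2 / 4] *)

Definition bessel_coeff (q : R) (n : nat) : R := / (Pochhammer (q + 1) n * INR (fact n)).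

Lemma Pochhammer_0 a : 0 < a -> Pochhammer a 0 = 1.
Proof.
  intros Ha; unfold Pochhammer; rewrite Rplus_0_r; field.
  apply Rgt_not_eq, Gamma_pos, Ha.
Qed.

Lemma Pochhammer_succ a n : 0 < a -> Pochhammer a (S n) = Pochhammer a n * (a + INR n).
Proof.
  intros Ha; unfold Pochhammer.
  rewrite S_INR, <- Rplus_assoc, Gamma_succ by (generalize (pos_INR n); lra).
  field; apply Rgt_not_eq, Gamma_pos, Ha.
Qed.

Lemma Pochhammer_pos a n : 0 < a -> 0 < Pochhammer a n.
Proof.
  intros Ha; apply Rdiv_lt_0_compat; apply Gamma_pos; generalize (pos_INR n); lra.
Qed.

Lemma bessel_coeff_0 q : -1 < q -> bessel_coeff q 0 = 1.
Proof. intros Hq; unfold bessel_coeff; rewrite Pochhammer_0 by lra; simpl; field. Qed.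

Lemma bessel_coeff_succ q n : -1 < q ->
  bessel_coeff q (S n) = bessel_coeff q n / ((INR n + 1) * (q + 1 + INR n)).
Proof.
  intros Hq; unfold bessel_coeff.
  rewrite Pochhammer_succ, fact_simpl, mult_INR, S_INR by lra.
  generalize (pos_INR n) (Pochhammer_pos (q + 1) n) (INR_fact_lt_0 n); intros.
  field; repeat split; lra.
Qed.

Lemma bessel_coeff_pos q n : -1 < q -> 0 < bessel_coeff q n.
Proof.
  intros Hq; apply Rinv_0_lt_compat, Rmult_lt_0_compat;
    [apply Pochhammer_pos; lra|apply INR_fact_lt_0].
Qed.

(** The Pochhammer identity [(q+1) (q+2)_n = (q+1)_n (q+1+n)]. It lets the series of orders [p] and
    [p + 1] be combined term by term. *)
Lemma bessel_coeff_shift q n : -1 < q ->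
  (q + 1) * bessel_coeff q n = (q + 1 + INR n) * bessel_coeff (q + 1) n.
Proof.
  intros Hq; induction n as [|n IH].
  - rewrite !bessel_coeff_0 by lra; simpl; ring.
  - rewrite !bessel_coeff_succ, S_INR by lra; generalize (pos_INR n); intros Hn.
    replace ((q + 1) * (bessel_coeff q n / ((INR n + 1) * (q + 1 + INR n))))
      with ((q + 1) * bessel_coeff q n / ((INR n + 1) * (q + 1 + INR n))) by (field; lra).
    rewrite IH; field; lra.
Qed.

Definition bessel_pseries (q : R) : R -> R :=
  PSeries (fun n => (-1) ^ n * bessel_coeff q n).

Lemma CV_radius_bessel q : -1 < q ->
  CV_radius (fun n => (-1) ^ n * bessel_coeff q n) = p_infty.
Proof.
  intros Hq; apply CV_radius_infinite_DAlembert.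
  - intros n; apply Rmult_integral_contrapositive_currified;
      [apply pow_nonzero; lra|apply Rgt_not_eq, bessel_coeff_pos, Hq].
  (* The ratio of consecutive coefficients is [1 / ((n+1) (q+1+n))] in absolute value, at most
     [1 / ((q+1) (n+1))]. *)
  - apply (is_lim_seq_le_le_loc (fun _ => 0) _ (fun n => / (q + 1) * / (INR n + 1))).
    + exists 0%nat; intros n _; split; [apply Rabs_pos|].
      generalize (pos_INR n) (bessel_coeff_pos q n Hq); intros Hn Hc.
      rewrite bessel_coeff_succ by exact Hq.
      replace ((-1) ^ S n * (bessel_coeff q n / ((INR n + 1) * (q + 1 + INR n)))
        / ((-1) ^ n * bessel_coeff q n)) with (- / ((INR n + 1) * (q + 1 + INR n))).
      2:{ simpl; field; repeat split; try lra; apply pow_nonzero; lra. }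
      rewrite Rabs_Ropp, Rabs_pos_eq, <- Rinv_mult
        by (left; apply Rinv_0_lt_compat, Rmult_lt_0_compat; lra).
      apply Rinv_le_contravar; nra.
    + apply is_lim_seq_const.
    + replace (Finite 0) with (Rbar_mult (/ (q + 1)) 0) by (simpl; f_equal; ring).
      apply is_lim_seq_scal_l.
      apply (is_lim_seq_ext (fun n => / INR (S n))); [intros n; now rewrite S_INR|].
      apply (is_lim_seq_incr_1 (fun n => / INR n)).
      apply (is_lim_seq_inv INR p_infty); [apply is_lim_seq_INR|discriminate].
Qed.

Lemma is_series_bessel q y : -1 < q ->
  is_series (fun n => (-1) ^ n * bessel_coeff q n * y ^ n) (bessel_pseries q y).
Proof.
  intros Hq; apply is_pseries_R, PSeries_correct, CV_radius_inside.
  now rewrite CV_radius_bessel.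
Qed.

Lemma normBesselJ_pseries q x : normBesselJ q x = bessel_pseries q (x ^ 2 / 4).
Proof.
  apply Series_ext; intros n; unfold bessel_coeff.
  unfold Rdiv; rewrite !Rpow_mult_distr, <- pow_mult; ring.
Qed.

Lemma bessel_pseries_0 q : -1 < q -> bessel_pseries q 0 = 1.
Proof.
  intros Hq; unfold bessel_pseries; rewrite PSeries_0, bessel_coeff_0 by exact Hq.
  simpl; ring.
Qed.

Lemma continuity_normBesselJ q : -1 < q -> continuity (normBesselJ q).
Proof.
  intros Hq x.
  apply (continuity_pt_ext (comp (bessel_pseries q) (fun t => t ^ 2 / 4))).
  { intros t; symmetry; apply normBesselJ_pseries. }
  apply continuity_pt_comp.
  - apply derivable_continuous_pt; reg.
  - apply PSeries_continuity; now rewrite CV_radius_bessel.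
Qed.

Lemma BesselJ_normBesselJ q x : -1 < q -> 0 < x ->
  BesselJ q x = Rpower (x / 2) q / Gamma (q + 1) * normBesselJ q x.
Proof.
  intros Hq Hx; unfold BesselJ, normBesselJ; rewrite <- Series_scal_l.
  apply Series_ext; intros n.
  assert (Hx2 : 0 < x / 2) by lra.
  replace (q + 2 * INR n) with (q + INR (2 * n)) by (rewrite mult_INR; simpl; ring).
  rewrite Rpower_plus, Rpower_pow by exact Hx2.
  unfold Pochhammer; replace (q + INR n + 1) with (q + 1 + INR n) by ring.
  replace ((x / 2) ^ (2 * n)) with ((1 / 4) ^ n * x ^ (2 * n)).
  2:{ rewrite !pow_mult, <- Rpow_mult_distr; f_equal; field. }
  replace (-1 / 4) with (-1 * (1 / 4)) by field; rewrite Rpow_mult_distr.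
  assert (0 < Gamma (q + 1)) by (apply Gamma_pos; lra).
  assert (0 < Gamma (q + 1 + INR n)) by (apply Gamma_pos; generalize (pos_INR n); lra).
  generalize (INR_fact_lt_0 n); intros; field; repeat split; lra.
Qed.

(** The factor between the two functions is positive for [x > 0], so the zero [j] of [BesselJ] can
    be studied through the power series. *)
Lemma BesselJ_eq_0 q x : -1 < q -> 0 < x -> BesselJ q x = 0 <-> normBesselJ q x = 0.
Proof.
  intros Hq Hx; rewrite BesselJ_normBesselJ by assumption.
  assert (Hc : 0 < Rpower (x / 2) q / Gamma (q + 1)).
  { apply Rdiv_lt_0_compat; [apply exp_pos|apply Gamma_pos; lra]. }
  split; [|intros ->; ring].
  intros H; apply Rmult_integral in H; lra.
Qed.

(** * Alternating series: Leibniz bounds and monotonicity in the variable *)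

Lemma is_series_Rmult (a : nat -> R) (c l : R) :
  is_series a l -> is_series (fun k => c * a k) (c * l).
Proof. exact (is_series_scal (K := R_AbsRing) (V := R_NormedModule) c a l). Qed.

Lemma is_series_Rplus (a b : nat -> R) (la lb : R) :
  is_series a la -> is_series b lb -> is_series (fun k => a k + b k) (la + lb).
Proof. exact (is_series_plus (K := R_AbsRing) (V := R_NormedModule) a b la lb). Qed.

Lemma is_series_eq (a b : nat -> R) (la lb : R) :
  is_series a la -> (forall k, a k = b k) -> la = lb -> is_series b lb.
Proof. intros Ha Hab <-; exact (is_series_ext a b la Hab Ha). Qed.

Lemma is_series_tail (a : nat -> R) (n : nat) (l : R) :
  is_series a l -> is_series (fun k => a (S n + k)%nat) (l - sum_n a n).
Proof.
  intros H; apply is_series_incr_n; [lia|]; simpl pred.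
  assert (E : forall u v : R, u - v + v = u) by (intros; ring).
  replace (plus _ _) with l by exact (eq_sym (E l (sum_n a n))); exact H.
Qed.

(** Splitting off the first term leaves [t 0] minus a sum of the same kind, which by induction lies
    between 0 and [t 1]. *)
Lemma sum_n_alternating_bounds (t : nat -> R) (n : nat) :
  (forall k, 0 <= t k) -> (forall k, t (S k) <= t k) ->
  0 <= sum_n (fun k => (-1) ^ k * t k) n <= t 0%nat.
Proof.
  revert t; induction n as [|n IH]; intros t Ht Hdec.
  - rewrite sum_O; simpl; generalize (Ht 0%nat); lra.
  - replace (sum_n (fun k => (-1) ^ k * t k) (S n))
      with (t 0%nat - sum_n (fun k => (-1) ^ k * t (S k)) n).
    + generalize (IH (fun k => t (S k)) (fun k => Ht (S k)) (fun k => Hdec (S k))).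
      generalize (Hdec 0%nat) (Ht 1%nat); lra.
    + unfold sum_n; rewrite (sum_Sn_m _ 0 (S n)), <- sum_n_m_S by lia.
      rewrite (sum_n_m_ext (fun k => (-1) ^ S k * t (S k))
        (fun k => mult (K := R_Ring) (-1) ((-1) ^ k * t (S k)))).
      * rewrite (sum_n_m_mult_l (K := R_Ring) (-1) (fun k => (-1) ^ k * t (S k))); unfold plus, mult; simpl.
        match goal with |- _ - ?X = _ => change (t 0%nat - X = 1 * t 0%nat + -1 * X) end; ring.
      * intros k; unfold mult; simpl; ring.
Qed.

Lemma is_series_alternating_bounds (t : nat -> R) (l : R) :
  (forall k, 0 <= t k) -> (forall k, t (S k) <= t k) ->
  is_series (fun k => (-1) ^ k * t k) l ->
  t 0%nat - t 1%nat <= l <= t 0%nat.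
Proof.
  assert (Hb : forall (t : nat -> R) (l : R),
    (forall k, 0 <= t k) -> (forall k, t (S k) <= t k) ->
    is_series (fun k => (-1) ^ k * t k) l -> 0 <= l <= t 0%nat).
  { clear t l; intros t l Ht Hdec Hl.
    assert (Hlim : is_lim_seq (sum_n (fun k => (-1) ^ k * t k)) l) by exact Hl.
    split.
    - apply (is_lim_seq_le (fun _ => 0) _ 0 l) with (3 := Hlim);
        [intros n; now apply sum_n_alternating_bounds|apply is_lim_seq_const].
    - apply (is_lim_seq_le _ (fun _ => t 0%nat) l (t 0%nat)) with (2 := Hlim);
        [intros n; now apply sum_n_alternating_bounds|apply is_lim_seq_const]. }
  intros Ht Hdec Hl; split; [|now apply Hb].
  (* The tail with its sign changed is alternating again; its upper bound [t 1] is the lower bound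
     for [l]. *)
  assert (H : is_series (fun k => (-1) ^ k * t (S k)) (t 0%nat - l)).
  { apply (is_series_eq _ _ _ _ (is_series_Rmult _ (-1) _ (is_series_tail _ 0 _ Hl))).
    - intros k; simpl; ring.
    - rewrite sum_O; simpl; ring. }
  apply Hb in H; [lra|intros k; apply Ht|intros k; apply Hdec].
Qed.

(** Factoring out [z - y] leaves [n] products of powers, each at least [y ^ (n-1)] and hence at
    least [y ^ n]. *)
Lemma pow_diff_lower (y z : R) (n : nat) : 0 <= y <= z -> z <= 1 ->
  INR n * (y ^ n * (z - y)) <= z ^ n - y ^ n.
Proof.
  intros Hy Hz; induction n as [|n IH]; [simpl; lra|].
  rewrite S_INR; simpl pow.
  assert (0 <= y ^ n) by (apply pow_le; lra).
  assert (y ^ n <= z ^ n) by (apply pow_incr; lra).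
  assert (y * (INR n * (y ^ n * (z - y))) <= y * (z ^ n - y ^ n))
    by (apply Rmult_le_compat_l; lra).
  assert (y * y ^ n * (z - y) <= z ^ n * (z - y)) by (apply Rmult_le_compat_r; nra).
  lra.
Qed.

(* The hypothesis on [s] makes [s k * (z ^ (k + 1) - y ^ (k + 1))] decrease in [k]. *)
Lemma alternating_series_incr (s : nat -> R) (y z ly lz : R) :
  (forall k, 0 <= s k) ->
  (forall k, (INR k + 2) * s (S k) <= (INR k + 1) * s k) ->
  2 * s 1%nat < s 0%nat ->
  0 <= y < z -> z <= 1 ->
  is_series (fun k => (-1) ^ k * s k * y ^ S k) ly ->
  is_series (fun k => (-1) ^ k * s k * z ^ S k) lz ->
  ly < lz.
Proof.
  intros Hs Hdec H01 Hy Hz Hly Hlz.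
  set (t := fun k => s k * (z ^ S k - y ^ S k)).
  assert (Ht : is_series (fun k => (-1) ^ k * t k) (lz - ly)).
  { apply (is_series_eq _ _ _ _ (is_series_Rplus _ _ _ _ Hlz (is_series_Rmult _ (-1) _ Hly)));
      [intros k; unfold t; ring|ring]. }
  apply is_series_alternating_bounds in Ht.
  - assert (0 < t 0%nat - t 1%nat); [|lra].
    unfold t; simpl pow.
    (* This product is [t 0 - t 1]; it is positive because [z + y < 2] and [2 * s 1 < s 0]. *)
    assert (0 < (z - y) * (s 0%nat - s 1%nat * (z + y))); [|lra].
    apply Rmult_lt_0_compat; [lra|]; generalize (Hs 1%nat); nra.
  - intros k; apply Rmult_le_pos; [apply Hs|].
    generalize (pow_incr y z (S k)); lra.
  - intros k; unfold t.
    generalize (pow_diff_lower y z (S k)); rewrite S_INR; intros H.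
    assert (H1 : (INR k + 1) * (y ^ S k * (z - y)) <= z ^ S k - y ^ S k) by (apply H; lra).
    clear H; specialize (Hdec k); generalize (pos_INR k) (Hs (S k)); intros Hk Hsk.
    set (d := z ^ S k - y ^ S k) in *.
    (* By [H1] the second summand is at most [d / (k+1)], and [z <= 1], so the new difference is at
       most [(k+2) / (k+1)] times [d]. *)
    replace (z ^ S (S k) - y ^ S (S k)) with (z * d + y ^ S k * (z - y))
      by (unfold d; simpl; ring).
    assert (Hd : 0 <= d) by (unfold d; generalize (pow_incr y z (S k)); lra).
    apply (Rmult_le_reg_l (INR k + 1)); [lra|].
    apply Rle_trans with (s (S k) * ((INR k + 2) * d)).
    + replace ((INR k + 1) * (s (S k) * (z * d + y ^ S k * (z - y)))) with
        (s (S k) * ((INR k + 1) * (z * d) + (INR k + 1) * (y ^ S k * (z - y)))) by ring.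
      apply Rmult_le_compat_l; [exact Hsk|].
      assert ((INR k + 1) * (z * d) <= (INR k + 1) * d) by (apply Rmult_le_compat_l; nra).
      lra.
    + replace (s (S k) * ((INR k + 2) * d)) with ((INR k + 2) * s (S k) * d) by ring.
      rewrite <- Rmult_assoc; now apply Rmult_le_compat_r.
Qed.

(** * The quotient [b = (1 - v) / y]: bounds and strict decrease *)

(* [1 - J_(q+1)(x) = y * bessel_quot q y] with [y = x ^ 2 / 4]. *)
Definition bessel_quot (q y : R) : R := (1 - bessel_pseries (q + 1) y) / y.

Lemma is_series_bessel_quot q y : -1 < q -> 0 < y ->
  is_series (fun k => (-1) ^ k * (bessel_coeff (q + 1) (S k) * y ^ k)) (bessel_quot q y).
Proof.
  intros Hq Hy.
  apply (is_series_eq _ _ _ _ (is_series_Rmult _ (- / y) _ (is_series_tail _ 0 _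
    (is_series_bessel (q + 1) y ltac:(lra))))).
  - intros k; simpl; field; lra.
  - rewrite sum_O, bessel_coeff_0 by lra; unfold bessel_quot; simpl; field; lra.
Qed.

(** Removing the constant term and flipping the sign gives the shape required by
    [alternating_series_incr], so that a decreasing quotient becomes an increasing series. *)
Lemma is_series_bessel_quot_tail q y : -1 < q -> 0 < y ->
  is_series (fun k => (-1) ^ k * bessel_coeff (q + 1) (S (S k)) * y ^ S k)
    (bessel_coeff (q + 1) 1 - bessel_quot q y).
Proof.
  intros Hq Hy.
  apply (is_series_eq _ _ _ _ (is_series_Rmult _ (-1) _ (is_series_tail _ 0 _
    (is_series_bessel_quot q y Hq Hy)))).
  - intros k; simpl; ring.
  - rewrite sum_O; simpl; ring.
Qed.

Lemma bessel_quot_bounds q y : -1 < q -> 0 < y <= 1 ->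
  bessel_coeff (q + 1) 1 - bessel_coeff (q + 1) 2 <= bessel_quot q y
    <= bessel_coeff (q + 1) 1.
Proof.
  intros Hq Hy.
  generalize (is_series_bessel_quot q y Hq (proj1 Hy)); intros H.
  apply is_series_alternating_bounds in H.
  - simpl in H; generalize (bessel_coeff_pos (q + 1) 2); nra.
  - intros k; apply Rmult_le_pos; [left; apply bessel_coeff_pos; lra|apply pow_le; lra].
  - intros k; rewrite (bessel_coeff_succ _ (S k)), S_INR by lra.
    generalize (pos_INR k) (bessel_coeff_pos (q + 1) (S k)) (pow_lt y k (proj1 Hy)).
    intros Hk Hc Hyk; simpl pow.
    apply (Rmult_le_reg_r ((INR k + 1 + 1) * (q + 1 + 1 + (INR k + 1)))); [nra|].
    replace (_ / _ * (y * y ^ k) * _) with (bessel_coeff (q + 1) (S k) * y ^ k * y)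
      by (field; lra).
    apply Rmult_le_compat_l; [apply Rmult_le_pos; lra|nra].
Qed.

Lemma bessel_quot_decr q y z : -1 < q -> 0 < y < z -> z <= 1 ->
  bessel_quot q z < bessel_quot q y.
Proof.
  intros Hq Hy Hz.
  assert (bessel_coeff (q + 1) 1 - bessel_quot q y < bessel_coeff (q + 1) 1 - bessel_quot q z);
    [|lra].
  assert (Hpos : forall n, 0 < bessel_coeff (q + 1) n)
    by (intros n; apply bessel_coeff_pos; lra).
  (* This yields the weighted decrease for every [k] and, at [k = 0], the strict inequality between
     the first two coefficients. *)
  assert (Hstep : forall k, 2 * (INR k + 2) * bessel_coeff (q + 1) (S (S (S k)))
    < (INR k + 1) * bessel_coeff (q + 1) (S (S k))).
  { intros k; rewrite (bessel_coeff_succ _ (S (S k))), !S_INR by lra.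
    generalize (pos_INR k) (Hpos (S (S k))); intros Hk Hc.
    apply (Rmult_lt_reg_r ((INR k + 1 + 1 + 1) * (q + 1 + 1 + (INR k + 1 + 1)))); [nra|].
    replace (_ * (_ / _) * _) with (bessel_coeff (q + 1) (S (S k)) * (2 * (INR k + 2)))
      by (field; lra).
    replace ((INR k + 1) * bessel_coeff (q + 1) (S (S k)) * _) with
      (bessel_coeff (q + 1) (S (S k)) *
        ((INR k + 1) * ((INR k + 1 + 1 + 1) * (q + 1 + 1 + (INR k + 1 + 1))))) by ring.
    apply Rmult_lt_compat_l; [exact Hc|nra]. }
  apply (alternating_series_incr (fun k => bessel_coeff (q + 1) (S (S k))) y z).
  - intros k; left; apply Hpos.
  - intros k; generalize (Hstep k) (Hpos (S (S (S k)))) (pos_INR k); nra.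
  - generalize (Hstep 0%nat); simpl INR; generalize (Hpos 3%nat); lra.
  - lra.
  - exact Hz.
  - apply is_series_bessel_quot_tail; lra.
  - apply is_series_bessel_quot_tail; lra.
Qed.

(** * The excess [h] over the constant [alpha]: expansion, positivity and growth *)

(* [(cusa_den - cusa_num) p (alpha p) x / y ^ 2] with [y = x ^ 2 / 4]. *)
Definition cusa_excess (p y : R) : R :=
  (1 / (p + 1) + bessel_pseries p y - (p + 2) / (p + 1) * bessel_pseries (p + 1) y
    - 4 * alpha p * y * (1 - bessel_pseries (p + 1) y)) / y ^ 2.

(** Absolute value of the coefficient of [y ^ (k+1)] in the excess; the factor [k - p] is positive
    because [p] is negative. *)
Definition cusa_coeff (p : R) (k : nat) : R :=
  bessel_coeff (p + 1) (S (S (S k))) * (INR k + 1) * (INR k - p) / (2 * (p + 1) * (p + 3)).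

(** The numerator of the excess has no terms in [1], [y] or [y ^ 2]; the choice of [alpha] is what
    cancels the last one. Hence the expansion starts with [y] after division by [y ^ 2]. *)
Lemma is_series_cusa_excess p y : -1 < p -> 0 < y ->
  is_series (fun k => (-1) ^ k * cusa_coeff p k * y ^ S k) (cusa_excess p y).
Proof.
  intros Hp Hy.
  assert (Hp1 : -1 < p + 1) by lra.
  (* All terms up to [y ^ 2] are dropped; the third series is cut one index earlier because it gets
     multiplied by [y]. *)
  generalize (is_series_tail _ 2 _ (is_series_bessel p y Hp))
    (is_series_tail _ 2 _ (is_series_bessel (p + 1) y Hp1))
    (is_series_tail _ 1 _ (is_series_bessel (p + 1) y Hp1)).
  intros Hu Hv Hw.
  apply (is_series_eq _ _ _ _ (is_series_Rplus _ _ _ _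
    (is_series_Rplus _ _ _ _ (is_series_Rmult _ (/ y ^ 2) _ Hu)
      (is_series_Rmult _ (- ((p + 2) / (p + 1) / y ^ 2)) _ Hv))
    (is_series_Rmult _ (4 * alpha p / y) _ Hw))).
  2:{ rewrite !sum_Sn, !sum_O; unfold plus; simpl.
    rewrite !bessel_coeff_succ, !bessel_coeff_0 by lra; simpl.
    unfold cusa_excess, alpha; field; repeat split; lra. }
  intros k; simpl Nat.add; simpl pow.
  generalize (bessel_coeff_shift p (S (S (S k))) Hp); intros Hsh.
  assert (Hc : bessel_coeff p (S (S (S k))) =
    (p + 1 + INR (S (S (S k)))) * bessel_coeff (p + 1) (S (S (S k))) / (p + 1))
    by (rewrite <- Hsh; field; lra).
  rewrite Hc; unfold cusa_coeff, alpha.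
  rewrite (bessel_coeff_succ _ (S (S k))) by lra.
  rewrite !S_INR; generalize (pos_INR k); intros Hk.
  field; repeat split; lra.
Qed.

Lemma cusa_coeff_pos p k : -1 < p < 0 -> 0 < cusa_coeff p k.
Proof.
  intros Hp; unfold cusa_coeff; generalize (pos_INR k); intros Hk.
  apply Rdiv_lt_0_compat; [|nra].
  repeat apply Rmult_lt_0_compat; try lra; apply bessel_coeff_pos; lra.
Qed.

(* For [k = 0] this amounts to [p ^ 2 + 4 * p + 1 < 0]. *)
Lemma cusa_coeff_decr p k : -1 < p <= -1 / 2 ->
  (INR k + 2) * cusa_coeff p (S k) < (INR k + 1) * cusa_coeff p k.
Proof.
  intros Hp; unfold cusa_coeff.
  rewrite (bessel_coeff_succ _ (S (S (S k)))), !S_INR by lra.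
  generalize (pos_INR k) (bessel_coeff_pos (p + 1) (S (S (S k))) ltac:(lra)).
  set (c := bessel_coeff _ _); set (K := INR k); intros HK Hc.
  assert (Hpoly : (K + 2) * (K + 2) * (K + 1 - p)
    < (K + 1) * (K + 1) * (K - p) * ((K + 4) * (K + 5 + p))).
  { assert (HK01 : K = 0 \/ 1 <= K).
    { destruct k as [|k]; [left; reflexivity|right; unfold K; rewrite S_INR].
      generalize (pos_INR k); lra. }
    destruct HK01 as [->|HK1]; [nra|].
    (* For [K >= 1], [K + 2 <= 3/2 (K + 1)] and [K + 1 - p <= 2 (K - p)]; the product of the
       constants is [9/2], less than [(K + 4) (K + 5 + p)]. *)
    apply Rle_lt_trans with (9 / 4 * ((K + 1) * (K + 1)) * (2 * (K - p))).
    - apply Rmult_le_compat; nra.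
    - replace (9 / 4 * ((K + 1) * (K + 1)) * (2 * (K - p)))
        with ((K + 1) * (K + 1) * (K - p) * (9 / 2)) by field.
      apply Rmult_lt_compat_l; [repeat apply Rmult_lt_0_compat; lra|nra]. }
  set (d := 2 * (p + 1) * (p + 3)); assert (Hd : 0 < d) by (unfold d; nra).
  apply (Rmult_lt_reg_r (d * ((K + 4) * (K + 5 + p)) / c)).
  { apply Rdiv_lt_0_compat; [repeat apply Rmult_lt_0_compat; lra|exact Hc]. }
  replace ((K + 2) * (c / ((K + 1 + 1 + 1 + 1) * (p + 1 + 1 + (K + 1 + 1 + 1))) *
    (K + 1 + 1) * (K + 1 - p) / d) * (d * ((K + 4) * (K + 5 + p)) / c))
    with ((K + 2) * (K + 2) * (K + 1 - p)) by (field; repeat split; lra).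
  replace ((K + 1) * (c * (K + 1) * (K - p) / d) * (d * ((K + 4) * (K + 5 + p)) / c))
    with ((K + 1) * (K + 1) * (K - p) * ((K + 4) * (K + 5 + p)))
    by (field; repeat split; lra).
  exact Hpoly.
Qed.

(** Leibniz bounds. Positivity gives the inequality with [alpha]; the linear upper bound makes the
    excess vanish at 0, which gives the sharpness of [alpha]. *)
Lemma cusa_excess_bounds p y : -1 < p <= -1 / 2 -> 0 < y <= 1 ->
  0 < cusa_excess p y <= cusa_coeff p 0 * y.
Proof.
  intros Hp Hy.
  assert (Hpos : forall k, 0 < cusa_coeff p k) by (intros k; apply cusa_coeff_pos; lra).
  assert (Hdec : forall k, cusa_coeff p (S k) < cusa_coeff p k).
  { intros k; generalize (cusa_coeff_decr p k Hp) (pos_INR k) (Hpos (S k)); nra. }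
  assert (H : is_series (fun k => (-1) ^ k * (cusa_coeff p k * y ^ S k)) (cusa_excess p y)).
  { apply (is_series_eq _ _ _ _ (is_series_cusa_excess p y ltac:(lra) ltac:(lra)));
      [intros k; ring|reflexivity]. }
  apply is_series_alternating_bounds in H.
  - simpl in H; generalize (Hdec 0%nat) (Hpos 0%nat) (Hpos 1%nat); intros.
    assert (cusa_coeff p 1 * y < cusa_coeff p 0 * y) by (apply Rmult_lt_compat_r; lra).
    assert (cusa_coeff p 1 * (y * y) <= cusa_coeff p 1 * y)
      by (apply Rmult_le_compat_l; nra).
    lra.
  - intros k; apply Rmult_le_pos; [left; apply Hpos|apply pow_le; lra].
  - intros k; apply Rmult_le_compat; try (left; apply Hpos); try (left; apply Hdec).
    + apply pow_le; lra.
    + assert (0 <= y ^ S k) by (apply pow_le; lra).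
      change (y ^ S (S k)) with (y * y ^ S k); nra.
Qed.

Lemma cusa_excess_incr p y z : -1 < p <= -1 / 2 -> 0 < y < z -> z <= 1 ->
  cusa_excess p y < cusa_excess p z.
Proof.
  intros Hp Hy Hz.
  apply (alternating_series_incr (cusa_coeff p) y z).
  - intros k; left; apply cusa_coeff_pos; lra.
  - intros k; left; now apply cusa_coeff_decr.
  - generalize (cusa_coeff_decr p 0 Hp); simpl INR; lra.
  - lra.
  - exact Hz.
  - apply is_series_cusa_excess; lra.
  - apply is_series_cusa_excess; lra.
Qed.

Lemma bessel_quot_pos q y : -1 < q -> 0 < y <= 1 -> 0 < bessel_quot q y.
Proof.
  intros Hq Hy; generalize (bessel_quot_bounds q y Hq Hy).
  rewrite (bessel_coeff_succ _ 1) by lra; simpl INR.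
  generalize (bessel_coeff_pos (q + 1) 1 ltac:(lra)); intros Hc.
  assert (bessel_coeff (q + 1) 1 / ((1 + 1) * (q + 1 + 1 + 1)) < bessel_coeff (q + 1) 1);
    [|lra].
  apply (Rmult_lt_reg_r ((1 + 1) * (q + 1 + 1 + 1))); [lra|].
  replace (_ / _ * _) with (bessel_coeff (q + 1) 1) by (field; lra).
  nra.
Qed.

(** Since [x ^ 2 = 4 y] and [1 - v = y b], moving the constant from [alpha] to [c] changes the
    difference by [-4 (c - alpha) y ^ 2 b]. Every claim thus becomes a question about the sign of
    the bracket. *)
Lemma cusa_den_sub_num p c x : -1 < p -> 0 < x ->
  cusa_den p c x - cusa_num p c x =
  (x ^ 2 / 4) ^ 2 *
    (cusa_excess p (x ^ 2 / 4) - 4 * (c - alpha p) * bessel_quot p (x ^ 2 / 4)).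
Proof.
  intros Hp Hx; unfold cusa_den, cusa_num, cusa_excess, bessel_quot.
  rewrite !normBesselJ_pseries; unfold alpha; field; repeat split; lra.
Qed.

(** * Location of the first positive zero *)

(** The first two terms add up to -1. The remainder alternates with decreasing terms, as [y <= 1],
    so it is at most its first term [2 (p+1) / (p+2)], which is below 1. *)
Lemma bessel_pseries_neg p : -1 < p <= -1 / 2 -> bessel_pseries p (2 * (p + 1)) < 0.
Proof.
  intros Hp; set (y := 2 * (p + 1)).
  assert (H : is_series (fun k => (-1) ^ k * (bessel_coeff p (S (S k)) * y ^ S (S k)))
    (bessel_pseries p y - (1 - y / (p + 1)))).
  { apply (is_series_eq _ _ _ _ (is_series_tail _ 1 _ (is_series_bessel p y ltac:(lra)))).
    - intros k; simpl; ring.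
    - rewrite sum_Sn, sum_O; unfold plus; simpl.
      rewrite bessel_coeff_succ, bessel_coeff_0 by lra; simpl; field; lra. }
  apply is_series_alternating_bounds in H.
  - destruct H as [_ H]; simpl in H.
    rewrite !bessel_coeff_succ, bessel_coeff_0 in H by lra; simpl in H.
    replace (1 - y / (p + 1)) with (-1) in H by (unfold y; field; lra).
    replace (1 / ((0 + 1) * (p + 1 + 0)) / ((1 + 1) * (p + 1 + 1)) * (y * (y * 1)))
      with (2 * (p + 1) / (p + 2)) in H by (unfold y; field; lra).
    assert (2 * (p + 1) / (p + 2) < 1); [|lra].
    apply (Rmult_lt_reg_r (p + 2)); [lra|].
    replace (_ / _ * _) with (2 * (p + 1)) by (field; lra); lra.
  - intros k; apply Rmult_le_pos; [left; apply bessel_coeff_pos; lra|].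
    apply pow_le; unfold y; lra.
  - intros k; rewrite (bessel_coeff_succ _ (S (S k))), !S_INR by lra.
    generalize (pos_INR k) (bessel_coeff_pos p (S (S k)) ltac:(lra)).
    assert (Hy : 0 < y <= 1) by (unfold y; lra).
    generalize (pow_lt y (S (S k)) (proj1 Hy)); intros Hyk Hk Hc.
    rewrite <- (tech_pow_Rmult y (S (S k))).
    apply (Rmult_le_reg_r ((INR k + 1 + 1 + 1) * (p + 1 + (INR k + 1 + 1)))); [nra|].
    replace (_ / _ * (y * _) * _) with (bessel_coeff p (S (S k)) * y ^ S (S k) * y)
      by (field; lra).
    apply Rmult_le_compat_l; [apply Rmult_le_pos; lra|nra].
Qed.

(** The value at 0 is 1, so a nonpositive value before [j] would force an earlier zero by the
    intermediate value theorem. *)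
Lemma normBesselJ_pos p j x : -1 < p -> first_positive_zero (BesselJ p) j ->
  0 <= x < j -> 0 < normBesselJ p x.
Proof.
  intros Hp [Hj [_ Hno]] Hx.
  assert (H0 : normBesselJ p 0 = 1).
  { rewrite normBesselJ_pseries; replace (0 ^ 2 / 4) with 0 by field.
    now apply bessel_pseries_0. }
  apply Rnot_le_lt; intros Hneg.
  destruct (IVT_gen (normBesselJ p) 0 x 0 (continuity_normBesselJ p Hp)) as [z [Hz Hz0]].
  { rewrite H0, Rmin_right, Rmax_left; lra. }
  rewrite Rmin_left, Rmax_right in Hz by lra.
  assert (z <> 0) by (intros ->; lra).
  apply (Hno z); [lra|]; apply BesselJ_eq_0; [exact Hp|lra|exact Hz0].
Qed.

Lemma first_zero_bound p j : -1 < p <= -1 / 2 -> first_positive_zero (BesselJ p) j ->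
  j ^ 2 / 4 <= 1.
Proof.
  intros Hp Hj; assert (Hj0 : 0 < j) by apply Hj.
  (* The point where [x ^ 2 / 4 = 2 (p+1)]: the function is negative there, so [j] cannot lie beyond
     it. *)
  set (x := 2 * sqrt (2 * (p + 1))).
  assert (Hx2 : x ^ 2 = 4 * (2 * (p + 1))).
  { unfold x; rewrite Rpow_mult_distr, pow2_sqrt by lra; ring. }
  assert (Hx0 : 0 <= x) by (unfold x; generalize (sqrt_pos (2 * (p + 1))); lra).
  destruct (Rlt_le_dec x j) as [H|H].
  - exfalso; generalize (normBesselJ_pos p j x ltac:(lra) Hj ltac:(lra)).
    rewrite normBesselJ_pseries, Hx2.
    replace (4 * (2 * (p + 1)) / 4) with (2 * (p + 1)) by field.
    generalize (bessel_pseries_neg p Hp); lra.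
  - assert (j ^ 2 <= x ^ 2) by (apply pow_incr; lra); lra.
Qed.

(** * The two inequalities on the interval up to [j], and their sharpness *)

Lemma div_lt_1_iff n d : 0 < d -> n / d < 1 <-> 0 < d - n.
Proof. intros Hd; rewrite (Rlt_div_l n 1 d Hd); lra. Qed.

Lemma div_gt_1_iff n d : 0 < d -> 1 < n / d <-> d - n < 0.
Proof. intros Hd; rewrite <- (Rlt_div_r 1 n d Hd); lra. Qed.

Section FirstZero.

Variables p j : R.
Hypothesis Hp : -1 < p <= -1 / 2.
Hypothesis Hj : first_positive_zero (BesselJ p) j.

Let Y := j ^ 2 / 4.

Lemma first_zero_sq : 0 < Y <= 1.
Proof.
  split; [|now apply (first_zero_bound p)].
  apply Rdiv_lt_0_compat; [apply pow_lt, Hj|lra].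
Qed.

(** As [J_p(j) = 0], [beta] is exactly the constant for which numerator and denominator agree at
    [x = j]. *)
Lemma beta_excess : 4 * (beta p j - alpha p) * bessel_quot p Y = cusa_excess p Y.
Proof.
  assert (HY := first_zero_sq).
  assert (Hu : bessel_pseries p Y = 0).
  { unfold Y; rewrite <- normBesselJ_pseries; apply BesselJ_eq_0; [lra|apply Hj|apply Hj]. }
  assert (Hj0 : 0 < j) by apply Hj.
  generalize (bessel_quot_pos p Y ltac:(lra) HY).
  unfold beta; rewrite !normBesselJ_pseries; fold Y.
  unfold cusa_excess; rewrite Hu; unfold bessel_quot.
  set (v := bessel_pseries (p + 1) Y); intros Hv.
  assert (v <> 1) by (intros H; rewrite H in Hv; unfold Rdiv in Hv; lra).
  replace (j ^ 2) with (4 * Y) by (unfold Y; field).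
  unfold alpha; field; repeat split; lra.
Qed.

Lemma alpha_lt_beta : alpha p < beta p j.
Proof.
  generalize (cusa_excess_bounds p Y Hp first_zero_sq)
    (bessel_quot_pos p Y ltac:(lra) first_zero_sq).
  rewrite <- beta_excess; nra.
Qed.

Lemma alpha_pos : 0 < alpha p.
Proof. apply Rdiv_lt_0_compat; [lra|nra]. Qed.

(** With [v] the value of order [p + 1] at [j], [beta j ^ 2 = 1/(p+1) - v/(1-v)], and [0 <= v < 1]
    because [Y <= 1] and the quotient is below 1. This keeps the denominators positive. *)
Lemma beta_sq_le : beta p j * j ^ 2 <= 1 / (p + 1).
Proof.
  assert (HY := first_zero_sq); assert (Hj0 : 0 < j) by apply Hj.
  assert (Hb := bessel_quot_bounds p Y ltac:(lra) HY).
  generalize (bessel_quot_pos p Y ltac:(lra) HY); intros Hq.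
  rewrite (bessel_coeff_succ _ 0), bessel_coeff_0 in Hb by lra; simpl INR in Hb.
  assert (Hc : 1 / ((0 + 1) * (p + 1 + 1 + 0)) < 1).
  { apply div_lt_1_iff; lra. }
  set (v := bessel_pseries (p + 1) Y).
  assert (Hv : v = 1 - Y * bessel_quot p Y) by (unfold v, bessel_quot; field; lra).
  assert (0 <= v < 1) by nra.
  unfold beta; rewrite normBesselJ_pseries; fold Y; fold v.
  apply (Rmult_le_reg_r (1 - v)); [lra|].
  replace (_ / _ * _ * _) with (1 / (p + 1) * (1 - v) - v) by (field; repeat split; lra).
  lra.
Qed.

Lemma cusa_den_pos c x : 0 < x < j -> c * x ^ 2 <= 1 / (p + 1) -> 0 < cusa_den p c x.
Proof.
  intros Hx Hc; unfold cusa_den.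
  generalize (normBesselJ_pos p j x ltac:(lra) Hj ltac:(lra)); lra.
Qed.

Lemma cusa_den_pos_le_beta c x : 0 < x < j -> c <= beta p j -> 0 < cusa_den p c x.
Proof.
  intros Hx Hc; apply cusa_den_pos; [exact Hx|].
  generalize alpha_pos alpha_lt_beta beta_sq_le; intros Ha Hab Hb.
  assert (0 < x ^ 2) by (apply pow_lt; lra).
  assert (x ^ 2 <= j ^ 2) by (apply pow_incr; lra).
  assert (c * x ^ 2 <= beta p j * x ^ 2) by (apply Rmult_le_compat_r; lra).
  assert (beta p j * x ^ 2 <= beta p j * j ^ 2) by (apply Rmult_le_compat_l; lra).
  lra.
Qed.

Lemma sq_between x : 0 < x < j -> 0 < x ^ 2 / 4 < Y.
Proof. intros Hx; unfold Y; split; nra. Qed.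

Lemma cusa_alpha x : 0 < x < j -> 0 < cusa_den p (alpha p) x - cusa_num p (alpha p) x.
Proof.
  intros Hx; assert (Hy := sq_between x Hx); assert (HY := first_zero_sq).
  rewrite cusa_den_sub_num by lra.
  apply Rmult_lt_0_compat; [apply pow_lt; lra|].
  generalize (cusa_excess_bounds p (x ^ 2 / 4) Hp ltac:(lra)).
  replace (4 * (alpha p - alpha p)) with 0 by ring; lra.
Qed.

(** The excess increases and the quotient decreases in [y], so the bracket, which vanishes at [Y]
    for [c = beta], is negative before it. *)
Lemma cusa_beta x : 0 < x < j -> cusa_den p (beta p j) x - cusa_num p (beta p j) x < 0.
Proof.
  intros Hx; assert (Hy := sq_between x Hx); assert (HY := first_zero_sq).
  rewrite cusa_den_sub_num by lra.
  set (y := x ^ 2 / 4) in *.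
  assert (0 < y ^ 2) by (apply pow_lt; lra).
  generalize (cusa_excess_incr p y Y Hp Hy ltac:(lra))
    (bessel_quot_decr p y Y ltac:(lra) Hy ltac:(lra)) beta_excess alpha_lt_beta.
  intros H1 H2 H3 H4.
  assert (4 * (beta p j - alpha p) * bessel_quot p Y
    < 4 * (beta p j - alpha p) * bessel_quot p y) by (apply Rmult_lt_compat_l; lra).
  nra.
Qed.

(** Near 0 the excess tends to 0 while [4 (c - alpha) b] stays above the positive constant
    [4 (c - alpha) m]. *)
Lemma alpha_sharp c : alpha p < c ->
  exists x, 0 < x < j /\ 0 < cusa_den p c x /\ cusa_den p c x - cusa_num p c x <= 0.
Proof.
  intros Hc; assert (HY := first_zero_sq); assert (Ha := alpha_pos).
  set (m := bessel_quot p 1).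
  assert (Hm : 0 < m) by (apply bessel_quot_pos; lra).
  assert (Hc0 := cusa_coeff_pos p 0 ltac:(lra)).
  (* [y1] keeps the denominator positive, and [y2] makes the linear bound on the excess at most
     [4 (c - alpha) m]; the bound [Y / 2] below ensures [x < j]. *)
  set (y1 := 1 / (4 * c * (p + 1))); set (y2 := 4 * (c - alpha p) * m / cusa_coeff p 0).
  assert (Hy1 : 0 < y1) by (apply Rdiv_lt_0_compat; nra).
  assert (Hy2 : 0 < y2) by (apply Rdiv_lt_0_compat; nra).
  set (y := Rmin (Y / 2) (Rmin y1 y2)).
  assert (Hy : 0 < y) by (repeat apply Rmin_glb_lt; lra).
  assert (HyY : y <= Y / 2) by apply Rmin_l.
  assert (Hyy1 : y <= y1) by (eapply Rle_trans; [apply Rmin_r|apply Rmin_l]).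
  assert (Hyy2 : y <= y2) by (eapply Rle_trans; [apply Rmin_r|apply Rmin_r]).
  set (x := 2 * sqrt y).
  assert (Hx : 0 < x) by (unfold x; generalize (sqrt_lt_R0 y Hy); lra).
  assert (Hxy : x ^ 2 = 4 * y) by (unfold x; rewrite Rpow_mult_distr, pow2_sqrt by lra; ring).
  assert (Hxj : 0 < x < j).
  { split; [exact Hx|]; apply Rnot_le_lt; intros H.
    assert (j ^ 2 <= x ^ 2) by (apply pow_incr; split; [left; apply Hj|exact H]).
    unfold Y in *; lra. }
  exists x; split; [exact Hxj|split].
  - apply cusa_den_pos; [exact Hxj|].
    replace (1 / (p + 1)) with (c * (4 * y1)) by (unfold y1; field; lra).
    rewrite Hxy; apply Rmult_le_compat_l; lra.
  - rewrite cusa_den_sub_num by lra.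
    replace (x ^ 2 / 4) with y by lra.
    assert (0 < y ^ 2) by (apply pow_lt; lra).
    assert (Hexc := cusa_excess_bounds p y Hp ltac:(lra)).
    assert (Hq := bessel_quot_decr p y 1 ltac:(lra) ltac:(lra) ltac:(lra)); fold m in Hq.
    assert (cusa_coeff p 0 * y <= cusa_coeff p 0 * y2) by (apply Rmult_le_compat_l; lra).
    assert (cusa_coeff p 0 * y2 = 4 * (c - alpha p) * m) by (unfold y2; field; lra).
    assert (4 * (c - alpha p) * m < 4 * (c - alpha p) * bessel_quot p y)
      by (apply Rmult_lt_compat_l; lra).
    nra.
Qed.

(** For [c < beta] the difference is already strictly positive at [j]; continuity carries the sign
    to a point just left of [j]. *)
Lemma beta_sharp c : c < beta p j ->
  exists x, 0 < x < j /\ 0 < cusa_den p c x - cusa_num p c x.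
Proof.
  intros Hc; assert (HY := first_zero_sq); assert (Hj0 : 0 < j) by apply Hj.
  set (g := fun x => cusa_den p c x - cusa_num p c x).
  assert (Hg : 0 < g j).
  { unfold g; rewrite cusa_den_sub_num by lra; fold Y.
    apply Rmult_lt_0_compat; [apply pow_lt; lra|].
    rewrite <- beta_excess; generalize (bessel_quot_pos p Y ltac:(lra) HY); nra. }
  assert (Hcont : continuity_pt g j).
  { assert (Hu := continuity_normBesselJ p ltac:(lra) j).
    assert (Hv := continuity_normBesselJ (p + 1) ltac:(lra) j).
    assert (Hsq : continuity_pt (fun x => c * x ^ 2) j)
      by (apply derivable_continuous_pt; reg).
    assert (Hk : forall k : R, continuity_pt (fun _ => k) j)
      by (intros k; apply derivable_continuous_pt; reg).
    apply (continuity_pt_minus (cusa_den p c) (cusa_num p c)).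
    - apply (continuity_pt_minus (fun x => 1 / (p + 1) + normBesselJ p x)
        (fun x => c * x ^ 2)); [|exact Hsq].
      now apply (continuity_pt_plus (fun _ => 1 / (p + 1)) (normBesselJ p)).
    - apply (continuity_pt_mult (fun x => (p + 2) / (p + 1) - c * x ^ 2)
        (normBesselJ (p + 1))); [|exact Hv].
      now apply (continuity_pt_minus (fun _ => (p + 2) / (p + 1)) (fun x => c * x ^ 2)). }
  apply continuity_pt_filterlim in Hcont.
  destruct (Hcont (fun v => 0 < v)) as [eps Heps].
  { now apply (open_gt 0). }
  (* [eps / 2] stays in the neighbourhood where the sign persists, and [j / 2] keeps [j - d]
     positive. *)
  set (d := Rmin (eps / 2) (j / 2)).
  assert (0 < eps) by apply cond_pos.
  assert (Hd : 0 < d) by (apply Rmin_glb_lt; lra).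
  assert (Hd1 : d <= eps / 2) by apply Rmin_l.
  assert (Hd2 : d <= j / 2) by apply Rmin_r.
  exists (j - d); split; [lra|].
  apply (Heps (j - d)); change (Rabs (j - d - j) < eps); apply Rabs_def1; lra.
Qed.

End FirstZero.

Theorem theorem1 (p j : R) (Hp : -1 < p <= -1 / 2)
    (Hj : first_positive_zero (BesselJ p) j) :
  (forall x : R, 0 < x < j ->
     cusa_den p (alpha p) x <> 0 /\ cusa_den p (beta p j) x <> 0 /\
     cusa_num p (alpha p) x / cusa_den p (alpha p) x < 1 /\
     1 < cusa_num p (beta p j) x / cusa_den p (beta p j) x) /\
  (forall c : R, alpha p < c ->
     exists x : R, 0 < x < j /\ cusa_den p c x <> 0 /\
       ~ cusa_num p c x / cusa_den p c x < 1) /\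
  (forall c : R, c < beta p j ->
     exists x : R, 0 < x < j /\ cusa_den p c x <> 0 /\
       ~ 1 < cusa_num p c x / cusa_den p c x).
Proof.
  split; [|split].
  - intros x Hx.
    assert (Ha : 0 < cusa_den p (alpha p) x)
      by (apply (cusa_den_pos_le_beta p j Hp Hj); [exact Hx|left; now apply alpha_lt_beta]).
    assert (Hb : 0 < cusa_den p (beta p j) x)
      by (apply (cusa_den_pos_le_beta p j Hp Hj); [exact Hx|apply Rle_refl]).
    repeat split; try lra.
    + apply div_lt_1_iff; [exact Ha|now apply (cusa_alpha p j Hp Hj)].
    + apply div_gt_1_iff; [exact Hb|now apply cusa_beta].
  - intros c Hc; destruct (alpha_sharp p j Hp Hj c Hc) as [x [Hx [Hd Hn]]].
    exists x; repeat split; try lra.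
    rewrite div_lt_1_iff by exact Hd; lra.
  - intros c Hc; destruct (beta_sharp p j Hp Hj c Hc) as [x [Hx Hn]].
    assert (Hd : 0 < cusa_den p c x) by (apply (cusa_den_pos_le_beta p j Hp Hj); lra).
    exists x; repeat split; try lra.
    rewrite div_gt_1_iff by exact Hd; lra.
Qed.
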